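(* Let $\mathfrak V\subseteq \mathrm{di}\text{-}\mathrm{Alg}_0$ be a variety of dialgebras over a field $\Bbbk$ of characteristic zero, and let $\widehat{\mathfrak V}\subseteq\mathrm{Alg}$ be the variety generated by all algebras $Z\boxtimes A$ with $Z\in\mathrm{pre}\text{-}\mathrm{Com}$ and $A\in\mathfrak V$. Then for every $n\ge 1$: (C1) $c_n(\mathfrak V)\le n\,c_n(\widehat{\mathfrak V})$; (C2) $c_n(\widehat{\mathfrak V})\le n\,c_n(\mathfrak V)$. In particular, $\mathfrak V$ has polynomial (respectively, intermediate) codimension growth rate if and only if $\widehat{\mathfrak V}$ has polynomial (respectively, intermediate) codimension growth rate.
   Context: $\Bbbk$ is a field of characteristic zero and $\Omega$ is a fixed index set. $\mathrm{Alg}$ is the variety of all linear spaces over $\Bbbk$ with bilinear operations $\circ_\omega$, $\omega\in\Omega$ (no identities imposed). $\mathrm{di}\text{-}\mathrm{Alg}_0$ is the variety of all linear spaces over $\Bbbk$ with bilinear operations $\vdash_\omega,\dashv_\omega$, $\omega\in\Omega$, satisfying $(x\vdash_\omega y-x\dashv_\omega y)\vdash_\mu z=0$ and $x\dashv_\mu(y\vdash_\omega z-y\dashv_\omega z)=0$ for all $\omega,\mu\in\Omega$; a variety of dialgebras is a subvariety of it. $\mathrm{pre}\text{-}\mathrm{Com}$ is the variety of algebras over $\Bbbk$ with one bilinear product satisfying $(xy+yx)z=x(yz)$ (pre-commutative, or Zinbiel, algebras). For $Z\in\mathrm{pre}\text{-}\mathrm{Com}$ and an algebra $A$ with operations $\vdash_\omega,\dashv_\omega$,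 the algebra $Z\boxtimes A$ is the space $Z\otimes A$ with operations $$(z\otimes a)\circ_\omega(w\otimes b)=zw\otimes(a\vdash_\omega b)+wz\otimes(a\dashv_\omega b),\quad z,w\in Z,\ a,b\in A,\ \omega\in\Omega.$$ For a variety $\mathfrak M$, $\mathfrak M(n)$ is the space of all multilinear polynomials of degree $n$ in $x_1,\dots,x_n$ in the free algebra $\mathfrak M\langle x_1,x_2,\dots\rangle$, and $c_n(\mathfrak M)=\dim\mathfrak M(n)$ is the $n$th codimension of $\mathfrak M$. The codimension growth of $\mathfrak M$ is polynomial if $c_n(\mathfrak M)$ is bounded above by a polynomial in $n$. It is intermediate if $c_n(\mathfrak M)$ is not bounded above by any polynomial in $n$ but is subexponential, i.e., for every real $a>1$ there is $C>0$ with $c_n(\mathfrak M)\le C a^n$ for all $n$. *)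

(* Defs.v *)
From HB Require Import structures.
From mathcomp Require Import all_boot all_order all_algebra generic_quotient.
From mathcomp Require Import boolp classical_sets functions cardinality reals.

Set Implicit Arguments.
Unset Strict Implicit.
Unset Printing Implicit Defensive.

Import Order.TTheory GRing.Theory Num.Theory.
Local Open Scope classical_set_scope.
Local Open Scope card_scope.
Local Open Scope quotient_scope.
Local Open Scope ring_scope.

Section Dimension.
Variables (k : fieldType) (E : lmodType k).
Implicit Types (P B : set E).

Definition lin_indep B := forall (s : seq E) (c : E -> k),
  uniq s -> [set` s] `<=` B -> \sum_(v <- s) c v *: v = 0 ->
  forall v, v \in s -> c v = 0.

Definition lin_span B : set E := [set x | exists (s : seq E) (c : E -> k),
  [set` s] `<=` B /\ x = \sum_(v <- s) c v *: v].

Definition is_basis P B := [/\ B `<=` P, lin_indep B & P `<=` lin_span B].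

Lemma is_basis_exists P : exists B, is_basis P B.
Proof.
pose Q B := B `<=` P /\ lin_indep B.
have QU (F : set (set E)) : F `<=` Q -> total_on F subset ->
    Q (\bigcup_(X in F) X).
  move=> FQ Ftot; split=> [x [X FX Xx]|s c us sF s0 v vs].
    by have [XP _] := FQ _ FX; exact: XP.
  have [X FX sX] : exists2 X, F X & [set` s] `<=` X.
    have [w Fw _] := sF _ vs.
    elim: s sF {us s0 vs} => [_|a s IHs sF]; first by exists w.
    have [|X FX sX] := IHs; first by move=> x xs; apply: sF; rewrite /= inE xs orbT.
    have [Y FY Ya] : (\bigcup_(X in F) X) a by apply: sF; rewrite /= inE eqxx.
    have [XY|YX] := Ftot _ _ FX FY.
      exists Y => // x; rewrite /= inE => /orP[/eqP->//|xs]; exact/XY/sX.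
    exists X => // x; rewrite /= inE => /orP[/eqP->|xs]; [exact: YX|exact: sX].
  by have [_ iX] := FQ _ FX; exact: (iX s c).
have [B [[BP iB] Bmax]] := Zorn_bigcup QU.
exists B; split=> // x Px; apply: contrapT => nBx.
have nxB : ~ B x.
  move=> Bx; apply: nBx; exists [:: x], (fun=> 1); split; last first.
    by rewrite big_seq1 scale1r.
  by move=> y; rewrite /= inE => /eqP->.
apply: (Bmax (B `|` [set x])).
  split; first by move=> y; left.
  by move=> /(_ x (or_intror erefl)).
split=> [y [/BP//|->//]|s c us sB s0 v vs].
have sB' y : y \in s -> y != x -> B y.
  by move=> ys /eqP yx; case: (sB y ys).
have remB : [set` rem x s] `<=` B.
  by move=> y; rewrite /= mem_rem_uniq // inE => /andP[yx ys]; exact: sB'.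
have [xs|xNs] := boolP (x \in s); last first.
  apply: (iB s c) => // y ys; apply: sB' => //.
  by apply: contraNneq xNs => <-.
move: s0; rewrite (perm_big _ (perm_to_rem xs)) big_cons /= => s0.
have cx0 : c x = 0.
  apply: contrapT => /eqP cx; apply: nBx.
  exists (rem x s), (fun y => - (c x)^-1 * c y); split=> //.
  under eq_bigr do rewrite -scalerA.
  rewrite -scaler_sumr; move/eqP: s0; rewrite addr_eq0 => /eqP.
  move=> /(congr1 (fun y => (c x)^-1 *: y)).
  by rewrite scalerA mulVf // scale1r scalerN -scaleNr.
have [->//|vx] := eqVneq v x.
move: s0; rewrite cx0 scale0r add0r => s0.
by apply: (iB _ _ _ remB s0); rewrite ?rem_uniq // mem_rem_uniq // inE vx.
Qed.

(* A chosen basis of the span of P. It stands for the possibly infinite cardinal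
   dim P, and is meant to be used only with #= and #<=. *)
Definition dim P : set E := sval (cid (is_basis_exists P)).

End Dimension.

(* Formal linear combinations of generators g : G, modulo those that vanish
   under every member of a given family of evaluations phi i : G -> W i. *)
Section FormalSums.
Variables (k : fieldType) (G : choiceType).

Definition fsum : Type := seq (k * G).

Definition feval (W : lmodType k) (phi : G -> W) (s : fsum) : W :=
  \sum_(p <- s) p.1 *: phi p.2.

Definition fscale (c : k) (s : fsum) : fsum := [seq (c * p.1, p.2) | p <- s].

Definition fmul (mu : G -> G -> fsum) (s t : fsum) : fsum :=
  flatten [seq fscale (p.1 * q.1) (mu p.2 q.2) | p <- s, q <- t].

Lemma feval_cat (W : lmodType k) (phi : G -> W) s t :
  feval phi (s ++ t) = feval phi s + feval phi t.
Proof. by rewrite /feval big_cat. Qed.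

Lemma feval_scale (W : lmodType k) (phi : G -> W) c s :
  feval phi (fscale c s) = c *: feval phi s.
Proof.
by rewrite /feval big_map scaler_sumr; apply: eq_bigr => p _; rewrite scalerA.
Qed.

Lemma feval_mul (W : lmodType k) (phi : G -> W) mu s t :
  feval phi (fmul mu s t) =
  \sum_(p <- s) \sum_(q <- t) (p.1 * q.1) *: feval phi (mu p.2 q.2).
Proof.
rewrite {1}/feval /fmul big_flatten big_allpairs_dep /=.
by apply: eq_bigr => p _; apply: eq_bigr => q _; rewrite -feval_scale.
Qed.

Variables (I : Type) (W : I -> lmodType k) (phi : forall i, G -> W i).

Definition feqv (s t : fsum) : bool :=
  `[< forall i, feval (@phi i) s = feval (@phi i) t >].

Lemma feqv_refl : reflexive feqv.
Proof. by move=> s; apply/asboolP. Qed.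

Lemma feqv_sym : symmetric feqv.
Proof. by move=> s t; apply/asboolP/asboolP => st i; rewrite st. Qed.

Lemma feqv_trans : transitive feqv.
Proof.
by move=> t s u /asboolP st /asboolP tu; apply/asboolP => i; rewrite st tu.
Qed.

Canonical feqv_equiv := EquivRel feqv feqv_refl feqv_sym feqv_trans.

Definition fquot := {eq_quot feqv}.
HB.instance Definition _ := Choice.on fquot.
HB.instance Definition _ := EqQuotient.on fquot.

Definition fpi (s : fsum) : fquot := \pi_fquot s.

Definition qeval i (x : fquot) : W i := feval (@phi i) (repr x).

Lemma qeval_pi i s : qeval i (fpi s) = feval (@phi i) s.
Proof.
rewrite /qeval /fpi; have /eqmodP/asboolP := reprK (\pi_fquot s).
by move=> /(_ i).
Qed.

Lemma qeval_inj x y : (forall i, qeval i x = qeval i y) -> x = y.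
Proof.
move=> xy; rewrite -[x]reprK -[y]reprK; apply/eqmodP/asboolP => i; exact: xy.
Qed.

Lemma fpi_eq s t :
  (forall i, feval (@phi i) s = feval (@phi i) t) -> fpi s = fpi t.
Proof. by move=> st; apply: qeval_inj => i; rewrite !qeval_pi. Qed.

Definition fquot_zero : fquot := fpi [::].
Definition fquot_opp (x : fquot) : fquot := fpi (fscale (-1) (repr x)).
Definition fquot_add (x y : fquot) : fquot := fpi (repr x ++ repr y).
Definition fquot_scale (c : k) (x : fquot) : fquot := fpi (fscale c (repr x)).

Let E0 i : qeval i fquot_zero = 0.
Proof. by rewrite qeval_pi /feval big_nil. Qed.
Let EN i x : qeval i (fquot_opp x) = - qeval i x.
Proof. by rewrite qeval_pi feval_scale scaleN1r. Qed.
Let ED i x y : qeval i (fquot_add x y) = qeval i x + qeval i y.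
Proof. by rewrite qeval_pi feval_cat. Qed.
Let EZ i c x : qeval i (fquot_scale c x) = c *: qeval i x.
Proof. by rewrite qeval_pi feval_scale. Qed.

Fact fquot_addA : associative fquot_add.
Proof. by move=> x y z; apply: qeval_inj => i; rewrite !ED addrA. Qed.
Fact fquot_addC : commutative fquot_add.
Proof. by move=> x y; apply: qeval_inj => i; rewrite !ED addrC. Qed.
Fact fquot_add0 : left_id fquot_zero fquot_add.
Proof. by move=> x; apply: qeval_inj => i; rewrite ED E0 add0r. Qed.
Fact fquot_addN : left_inverse fquot_zero fquot_opp fquot_add.
Proof. by move=> x; apply: qeval_inj => i; rewrite ED EN E0 addNr. Qed.

HB.instance Definition _ := GRing.isZmodule.Build fquot
  fquot_addA fquot_addC fquot_add0 fquot_addN.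

Fact fquot_scaleA a b v :
  fquot_scale a (fquot_scale b v) = fquot_scale (a * b) v.
Proof. by apply: qeval_inj => i; rewrite !EZ scalerA. Qed.
Fact fquot_scale1 : left_id 1 fquot_scale.
Proof. by move=> x; apply: qeval_inj => i; rewrite EZ scale1r. Qed.
Fact fquot_scaleDr : right_distributive fquot_scale +%R.
Proof. by move=> c x y; apply: qeval_inj => i; rewrite EZ !ED !EZ scalerDr. Qed.
Fact fquot_scaleDl v : {morph fquot_scale^~ v : a b / a + b}.
Proof. by move=> a b; apply: qeval_inj => i; rewrite ED !EZ scalerDl. Qed.

HB.instance Definition _ := GRing.Zmodule_isLmodule.Build k fquot
  fquot_scaleA fquot_scale1 fquot_scaleDr fquot_scaleDl.

Lemma qeval_linear i : linear (qeval i).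
Proof. by move=> c x y; rewrite ED EZ. Qed.

Section Product.
Variable mu : G -> G -> fsum.
Hypothesis mul_l : forall i h, exists j (f : {linear W j -> W i}),
  forall g, feval (@phi i) (mu g h) = f (phi j g).
Hypothesis mul_r : forall i g, exists j (f : {linear W j -> W i}),
  forall h, feval (@phi i) (mu g h) = f (phi j h).

Definition fquot_mul (x y : fquot) : fquot := fpi (fmul mu (repr x) (repr y)).

Let mul_lE i t : exists F : seq (k * {j & {linear W j -> W i}}), forall s,
  feval (@phi i) (fmul mu s t) =
  \sum_(q <- F) q.1 *: projT2 q.2 (feval (@phi _) s).
Proof.
elim: t => [|[c h] t [F FE]].
  exists [::] => s; rewrite feval_mul big_nil big1 // => p _; exact: big_nil.
have [j [f fE]] := mul_l i h; exists ((c, existT _ j f) :: F) => s.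
rewrite big_cons -FE !feval_mul /=.
under eq_bigr do rewrite big_cons.
rewrite big_split /=; congr (_ + _).
rewrite /feval linear_sum scaler_sumr; apply: eq_bigr => p _.
by rewrite linearZ /= -fE scalerA [c * _]mulrC.
Qed.

Let mul_rE i s : exists F : seq (k * {j & {linear W j -> W i}}), forall t,
  feval (@phi i) (fmul mu s t) =
  \sum_(q <- F) q.1 *: projT2 q.2 (feval (@phi _) t).
Proof.
elim: s => [|[c g] s [F FE]].
  by exists [::] => t; rewrite feval_mul !big_nil.
have [j [f fE]] := mul_r i g; exists ((c, existT _ j f) :: F) => t.
rewrite big_cons -FE !feval_mul big_cons /=; congr (_ + _).
rewrite /feval linear_sum scaler_sumr; apply: eq_bigr => p _.
by rewrite linearZ /= -fE scalerA.
Qed.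

Lemma fquot_mul_pi s t : fquot_mul (fpi s) (fpi t) = fpi (fmul mu s t).
Proof.
apply: fpi_eq => i; have [F FE] := mul_lE i (repr (fpi t)).
have [F' F'E] := mul_rE i s; rewrite FE.
transitivity (feval (@phi i) (fmul mu s (repr (fpi t)))).
  by rewrite FE; apply: eq_bigr => q _; rewrite -!/(qeval _ _) qeval_pi.
by rewrite !F'E; apply: eq_bigr => q _; rewrite -!/(qeval _ _) qeval_pi.
Qed.

Lemma fquot_mul_linearl y : linear (fquot_mul^~ y).
Proof.
move=> c x x'; apply: qeval_inj => i; rewrite qeval_linear !qeval_pi.
have [F FE] := mul_lE i (repr y); rewrite !FE scaler_sumr -big_split /=.
apply: eq_bigr => q _; rewrite -!/(qeval _ _) qeval_linear linearP scalerDr.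
by rewrite !scalerA mulrC.
Qed.

Lemma fquot_mul_linearr x : linear (fquot_mul x).
Proof.
move=> c y y'; apply: qeval_inj => i; rewrite qeval_linear !qeval_pi.
have [F FE] := mul_rE i (repr x); rewrite !FE scaler_sumr -big_split /=.
apply: eq_bigr => q _; rewrite -!/(qeval _ _) qeval_linear linearP scalerDr.
by rewrite !scalerA mulrC.
Qed.

End Product.
End FormalSums.
Arguments fquot_mul {k G I W} phi mu x y.

Record algebra (k : fieldType) (Omega : Type) := Algebra {
  carrier :> lmodType k;
  op : Omega -> carrier -> carrier -> carrier;
  op_bilinear : forall w, bilinear_for *:%R *:%R (op w) }.
Arguments op_bilinear {k Omega a} w.

Inductive monomial (Omega : Type) : Type :=
| Var of nat
| Mul of Omega & monomial Omega & monomial Omega.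
Arguments Var {Omega} _.

HB.instance Definition _ (Omega : Type) := gen_eqMixin (monomial Omega).
HB.instance Definition _ (Omega : Type) := gen_choiceMixin (monomial Omega).

Fixpoint leaves (Omega : Type) (m : monomial Omega) : seq nat :=
  if m is Mul _ m1 m2 then leaves m1 ++ leaves m2 else
  if m is Var i then [:: i] else [::].

Section Varieties.
Variables (k : fieldType) (Omega : Type).
Implicit Types A : algebra k Omega.

Fixpoint meval A (a : nat -> A) (m : monomial Omega) : A :=
  match m with
  | Var i => a i
  | Mul w m1 m2 => op w (meval a m1) (meval a m2)
  end.

(* Representatives of the elements of the absolutely free algebra. *)
Definition nonassoc_poly := fsum k (monomial Omega).

Definition identity A (f : nonassoc_poly) :=
  forall a : nat -> A, feval (meval a) f = 0.

(* Plain predicates rather than set (algebra k Omega), which would be universe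
   inconsistent. *)
Definition algebra_class := algebra k Omega -> Prop.

Definition subclass (K M : algebra_class) := forall A, K A -> M A.

Definition is_variety (M : algebra_class) := exists S : set nonassoc_poly,
  forall A, M A <-> forall f, S f -> identity A f.

Definition generated_variety (K : algebra_class) : algebra_class :=
  fun A => forall M, is_variety M -> subclass K M -> M A.

Section FreeAlgebra.
Variable M : algebra_class.

Record interpretation := Interpretation {
  int_alg : algebra k Omega;
  int_mem : M int_alg;
  int_val : nat -> int_alg }.

Definition int_eval (i : interpretation) : monomial Omega -> int_alg i :=
  meval (@int_val i).

(* The free algebra of M: polynomials modulo the identities of M. *)
Definition free_car : lmodType k := fquot int_eval.

Definition free_class (f : nonassoc_poly) : free_car := fpi int_eval f.

Definition mono_mul w (m1 m2 : monomial Omega) : nonassoc_poly :=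
  [:: (1, Mul w m1 m2)].

Definition free_op w : free_car -> free_car -> free_car :=
  fquot_mul int_eval (mono_mul w).

Let mono_mulE i w g h :
  feval (@int_eval i) (mono_mul w g h) = op w (int_eval i g) (int_eval i h).
Proof. by rewrite /feval big_seq1 scale1r. Qed.

Fact free_op_bilinear w : bilinear_for *:%R *:%R (free_op w).
Proof.
split; [apply: fquot_mul_linearl => i h | apply: fquot_mul_linearr => i g].
  pose f := op w ^~ (int_eval i h).
  pose fL := GRing.isLinear.Build _ _ _ _ f ((op_bilinear w).1 _).
  pose F : {linear int_alg i -> int_alg i} := HB.pack f fL.
  by exists i, F => g; exact: mono_mulE.
pose f := op w (int_eval i g).
pose fL := GRing.isLinear.Build _ _ _ _ f ((op_bilinear w).2 _).
pose F : {linear int_alg i -> int_alg i} := HB.pack f fL.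
by exists i, F => h; exact: mono_mulE.
Qed.

Definition free_algebra : algebra k Omega := Algebra free_op_bilinear.

Definition is_multilinear n (m : monomial Omega) : bool :=
  perm_eq (leaves m) (iota 0 n).

(* M(n), with Var i for x_{i+1}. *)
Definition multilinear_part n : set free_algebra :=
  [set x | exists2 f : nonassoc_poly,
             all (fun p => is_multilinear n p.2) f & x = free_class f].

(* c_n(M), as a cardinal; see dim. *)
Definition codim n : set free_algebra := dim (multilinear_part n).

End FreeAlgebra.
Arguments multilinear_part M n : clear implicits.
Arguments codim M n : clear implicits.

Section Growth.
Variables (R : realType) (M : algebra_class).

(* c_n(M) is finite and at most x. *)
Definition codim_le n (x : R) := exists2 c : nat, codim M n #= `I_c & c%:R <= x.

Definition polynomial_growth := exists p : {poly R},
  forall n, (0 < n)%N -> codim_le n p.[n%:R].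

Definition subexponential := forall a : R, 1 < a -> exists2 C : R, 0 < C &
  forall n, (0 < n)%N -> codim_le n (C * a ^+ n).

Definition intermediate_growth := ~ polynomial_growth /\ subexponential.

End Growth.
End Varieties.
Arguments free_class {k Omega} M f.
Arguments multilinear_part {k Omega} M n.
Arguments codim {k Omega} M n.
Arguments polynomial_growth {k Omega} R M.
Arguments intermediate_growth {k Omega} R M.

Section Tensor.
Variables (k : fieldType) (U V : lmodType k).

Record bilinear_map := BilinearMap {
  bil_cod : lmodType k;
  bil_fun : U -> V -> bil_cod;
  bil_bilinear : bilinear_for *:%R *:%R bil_fun }.

Definition bil_eval (i : bilinear_map) (g : U * V) : bil_cod i :=
  bil_fun i g.1 g.2.

(* Formal sums of pairs (u, v) modulo those killed by every bilinear map. *)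
Definition tensor : lmodType k := fquot bil_eval.

Definition tens (u : U) (v : V) : tensor := fpi bil_eval [:: (1, (u, v))].

Lemma tens_bilinear : bilinear_for *:%R *:%R tens.
Proof.
split=> x c y z; apply: qeval_inj => i;
  rewrite qeval_linear !qeval_pi /feval !big_seq1 !scale1r /bil_eval /=.
- exact: (bil_bilinear i).1.
- exact: (bil_bilinear i).2.
Qed.

Lemma tens_universal (X : lmodType k) (b : U -> V -> X) :
  bilinear_for *:%R *:%R b ->
  exists2 f : tensor -> X, linear f & forall u v, f (tens u v) = b u v.
Proof.
move=> bb; exists (qeval (phi := bil_eval) (BilinearMap bb)).
  exact: (@qeval_linear _ _ _ _ bil_eval (BilinearMap bb)).
by move=> u v; rewrite qeval_pi /feval big_seq1 scale1r.
Qed.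

End Tensor.

(* A dialgebra has operations indexed by Omega + Omega, where inl w and inr w
   stand for |-_w and -|_w. *)
Definition dialgebra (k : fieldType) (Omega : Type) := algebra k (Omega + Omega).

Definition opl (k : fieldType) (Omega : Type) (A : dialgebra k Omega) (w : Omega)
  : A -> A -> A := op (inl w).
Definition opr (k : fieldType) (Omega : Type) (A : dialgebra k Omega) (w : Omega)
  : A -> A -> A := op (inr w).

Definition di_alg0 (k : fieldType) (Omega : Type) : algebra_class k (Omega + Omega) :=
  fun A : dialgebra k Omega => forall (w u : Omega) (x y z : A),
    opl u (opl w x y - opr w x y) z = 0 /\ opr u x (opl w y z - opr w y z) = 0.

Definition pre_com (k : fieldType) : algebra_class k unit :=
  fun Z => forall x y z : Z,
    op tt (op tt x y + op tt y x) z = op tt x (op tt y z).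

Section Box.
Variables (k : fieldType) (Omega : Type).
Variables (Z : algebra k unit) (A : dialgebra k Omega).

Local Notation "z ** w" := (op tt z w) (at level 40).

Definition box_mul (o : Omega) (g h : Z * A) : fsum k (Z * A)%type :=
  [:: (1, (g.1 ** h.1, opl o g.2 h.2)); (1, (h.1 ** g.1, opr o g.2 h.2))].

Definition box_op (o : Omega) : tensor Z A -> tensor Z A -> tensor Z A :=
  fquot_mul (@bil_eval k Z A) (box_mul o).

Let box_mulE (i : bilinear_map Z A) o g h :
  feval (@bil_eval _ _ _ i) (box_mul o g h) =
  bil_fun i (g.1 ** h.1) (opl o g.2 h.2) + bil_fun i (h.1 ** g.1) (opr o g.2 h.2).
Proof. by rewrite /feval /box_mul big_cons big_seq1 !scale1r. Qed.

Let opDl (Om : Type) (B : algebra k Om) (w : Om) c (x y z : B) :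
  op w (c *: x + y) z = c *: op w x z + op w y z.
Proof. exact: (op_bilinear w).1. Qed.
Let opDr (Om : Type) (B : algebra k Om) (w : Om) c (x y z : B) :
  op w z (c *: x + y) = c *: op w z x + op w z y.
Proof. exact: (op_bilinear w).2. Qed.
Let bilDl (i : bilinear_map Z A) c x y z :
  bil_fun i (c *: x + y) z = c *: bil_fun i x z + bil_fun i y z.
Proof. exact: (bil_bilinear i).1. Qed.
Let bilDr (i : bilinear_map Z A) c x y z :
  bil_fun i z (c *: x + y) = c *: bil_fun i z x + bil_fun i z y.
Proof. exact: (bil_bilinear i).2. Qed.

Let box_mul_l o i h : exists j (f : {linear bil_cod j -> bil_cod i}),
  forall g, feval (@bil_eval _ Z A i) (box_mul o g h) = f (@bil_eval _ Z A j g).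
Proof.
have bil : bilinear_for *:%R *:%R
    (fun z a => feval (@bil_eval _ Z A i) (box_mul o (z, a) h)).
  by split=> x c y z; rewrite !box_mulE /= /opl /opr ?(opDl, opDr) ?(bilDl, bilDr)
    scalerDr addrACA.
by exists (BilinearMap bil), idfun => -[].
Qed.

Let box_mul_r o i g : exists j (f : {linear bil_cod j -> bil_cod i}),
  forall h, feval (@bil_eval _ Z A i) (box_mul o g h) = f (@bil_eval _ Z A j h).
Proof.
have bil : bilinear_for *:%R *:%R
    (fun z a => feval (@bil_eval _ Z A i) (box_mul o g (z, a))).
  by split=> x c y z; rewrite !box_mulE /= /opl /opr ?(opDl, opDr) ?(bilDl, bilDr)
    scalerDr addrACA.
by exists (BilinearMap bil), idfun => -[].
Qed.

Fact box_op_bilinear o : bilinear_for *:%R *:%R (box_op o).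
Proof.
split; [apply: fquot_mul_linearl | apply: fquot_mul_linearr].
- exact: box_mul_l.
- exact: box_mul_r.
Qed.

Definition box : algebra k Omega := Algebra box_op_bilinear.

Lemma box_opE o z a w b :
  op (a := box) o (tens z a) (tens w b) =
  tens (z ** w) (opl o a b) + tens (w ** z) (opr o a b) :> tensor Z A.
Proof.
rewrite /= /box_op /tens fquot_mul_pi; first last.
- exact: box_mul_r.
- exact: box_mul_l.
apply: qeval_inj => i; rewrite -[X in X + _]scale1r qeval_linear !qeval_pi.
by rewrite scale1r feval_mul !big_seq1 mulr1 scale1r box_mulE /feval !big_seq1
  !scale1r.
Qed.

End Box.

(* \widehat V *)
Definition hat (k : fieldType) (Omega : Type) (V : algebra_class k (Omega + Omega))
  : algebra_class k Omega :=
  generated_variety (fun B => exists (Z : algebra k unit) (A : dialgebra k Omega),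
    [/\ pre_com Z, V A & B = box Z A]).

(* Main.v *)
From HB Require Import structures.
Require Import Defs.
From mathcomp Require Import all_boot all_order all_algebra.
From mathcomp Require Import boolp classical_sets functions cardinality reals.

Set Implicit Arguments.
Unset Strict Implicit.
Unset Printing Implicit Defensive.

Import Order.TTheory GRing.Theory Num.Theory.
Local Open Scope classical_set_scope.
Local Open Scope card_scope.
Local Open Scope ring_scope.

(* In a di-Alg_0 dialgebra, a multilinear dialgebra monomial depends only on the
   underlying monomial m and on its center j; write m^(j) for its value. When Z
   is Zinbiel, m evaluated at pure tensors z_i (x) a_i is the sum over j of
   E_j (x) m^(j)(a), where E_j is the sum of all Zinbiel words in the z_i ending
   with z_j, whatever the shape of m. Taking Z = k[t] with
   p . q = \int (p - p(0)) q' and z_i = t^{e_i} makes E_j proportional to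
   e_j t^{e_1 + ... + e_n}, and varying the exponents separates the m^(j). Hence
   a multilinear f is an identity of the hat variety iff all the f^(j) are
   identities of V, so the multilinear part of the free algebra of hat V embeds
   in n copies of that of V. Conversely, the images of the n maps f |-> f^(j)
   span the multilinear part of the free algebra of V. *)

(** * Spans, independence and Steinitz exchange in arbitrary cardinality *)

Section Span.
Variables (k : fieldType) (E : lmodType k).
Implicit Types (P B D S : set E).

(** [lin_span] admits lists with repetitions, [lin_indep] tests only duplicate-free ones;
    multiplicities are absorbed into the coefficients. *)
Lemma lin_span_uniq B x : lin_span B x -> exists (s : seq E) (c : E -> k),
  [/\ uniq s, [set` s] `<=` B & x = \sum_(v <- s) c v *: v].
Proof.
move=> [s [c [sB ->]]]; exists (undup s), (fun v => c v *+ count_mem v s).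
split; rewrite ?undup_uniq //.
  by move=> v /=; rewrite mem_undup; exact: sB.
rewrite -big_undup_iterop_count; apply: eq_bigr => v _.
by rewrite -scalerMnl.
Qed.

Lemma big_seq_widen (s r : seq E) (c : E -> k) :
  uniq s -> uniq r -> {subset s <= r} ->
  \sum_(v <- s) c v *: v = \sum_(v <- r) (if v \in s then c v else 0) *: v.
Proof.
move=> us ur sr; rewrite [RHS](bigID (mem s)) /= [X in _ + X]big1 ?addr0; last first.
  by move=> v /negbTE->; rewrite scale0r.
rewrite -[RHS]big_filter (perm_big (filter (mem s) r)).
  by apply: eq_big_seq => v; rewrite mem_filter /= => /andP[->].
apply: uniq_perm; rewrite ?filter_uniq // => v; rewrite mem_filter /=.
by case vs: (v \in s) => //=; rewrite sr.
Qed.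

Lemma lin_span0 B : lin_span B 0.
Proof. by exists [::], (fun=> 0); rewrite big_nil. Qed.

Lemma lin_spanD B x y : lin_span B x -> lin_span B y -> lin_span B (x + y).
Proof.
move=> /lin_span_uniq[s [c [us sB ->]]] /lin_span_uniq[t [d [ut tB ->]]].
exists (undup (s ++ t)), (fun v => (if v \in s then c v else 0) +
                                   (if v \in t then d v else 0)); split.
  by move=> v /=; rewrite mem_undup mem_cat => /orP[/sB|/tB].
under [RHS]eq_bigr do rewrite scalerDl.
rewrite big_split /=; congr (_ + _); apply: big_seq_widen;
  by rewrite ?undup_uniq // => v vs; rewrite mem_undup mem_cat vs ?orbT.
Qed.

Lemma lin_spanZ B a x : lin_span B x -> lin_span B (a *: x).
Proof.
move=> [s [c [sB ->]]]; exists s, (fun v => a * c v); split=> //.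
by rewrite scaler_sumr; apply: eq_bigr => v _; rewrite scalerA.
Qed.

Lemma sub_lin_span B : B `<=` lin_span B.
Proof.
move=> x Bx; exists [:: x], (fun=> 1); split; last by rewrite big_seq1 scale1r.
by move=> y; rewrite /= inE => /eqP->.
Qed.

Lemma lin_span_sum B (I : eqType) (s : seq I) (c : I -> k) (F : I -> E) :
  (forall i, i \in s -> lin_span B (F i)) ->
  lin_span B (\sum_(i <- s) c i *: F i).
Proof.
elim: s => [|i s IHs] sB; first by rewrite big_nil; exact: lin_span0.
rewrite big_cons; apply: lin_spanD.
  by apply: lin_spanZ; apply: sB; rewrite inE eqxx.
by apply: IHs => j js; apply: sB; rewrite inE js orbT.
Qed.

Lemma lin_span_trans B D : B `<=` lin_span D -> lin_span B `<=` lin_span D.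
Proof. by move=> BD x [s [c [sB ->]]]; apply: lin_span_sum => v /sB/BD. Qed.

Lemma lin_indep_sub B D : B `<=` D -> lin_indep D -> lin_indep B.
Proof. by move=> BD iD s c us sB; apply: iD => // v /sB/BD. Qed.

Lemma lin_indep_notin_span D b :
  lin_indep D -> D b -> ~ lin_span (D `\ b) b.
Proof.
move=> iD Db /lin_span_uniq[s [c [us sD bE]]].
have bs : b \notin s by apply/negP => /sD[_]; apply.
pose d v := if v == b then -1 else c v.
have d0 : \sum_(v <- b :: s) d v *: v = 0.
  rewrite big_cons {1}/d eqxx scaleN1r {1}bE addrC; apply/eqP; rewrite subr_eq0.
  apply/eqP/eq_big_seq => v vs; rewrite /d ifN //.
  by apply: contraNneq bs => <-.
have bsD : [set` b :: s] `<=` D.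
  by move=> v /=; rewrite inE => /orP[/eqP->//|/sD[]].
have := iD (b :: s) d _ bsD d0 b; rewrite /= bs us inE eqxx /d eqxx.
by move=> /(_ isT isT)/eqP; rewrite oppr_eq0 oner_eq0.
Qed.

Lemma lin_indepU1 D x : lin_indep D -> ~ lin_span D x -> lin_indep (D `|` [set x]).
Proof.
move=> iD Dx s c us sD s0.
have rD : [set` rem x s] `<=` D.
  move=> v; rewrite /= mem_rem_uniq // inE => /andP[/eqP vx /sD[]//].
have [xs|xs] := boolP (x \in s); last first.
  by apply: (iD s) => //; move: rD; rewrite rem_id.
move: s0; rewrite (perm_big _ (perm_to_rem xs)) big_cons /= => s0.
have cx : c x = 0.
  apply: contrapT => /eqP cx; apply: Dx.
  have -> : x = (- (c x)^-1) *: \sum_(v <- rem x s) c v *: v.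
    move/eqP: s0; rewrite addrC addr_eq0 => /eqP->.
    by rewrite scalerN scaleNr opprK scalerA mulVf // scale1r.
  by apply: lin_spanZ; apply: lin_span_sum => v /rD; exact: sub_lin_span.
move=> v vs; have [->//|vx] := eqVneq v x.
move: s0; rewrite cx scale0r add0r => s0.
by apply: (iD _ _ _ rD s0); rewrite ?rem_uniq // mem_rem_uniq // inE vx.
Qed.

(* Zorn's lemma is applied to graphs G of partial injections from B to S such
   that exchanging the domain of G for its range in B leaves B independent. *)
Let exchange B (G : set (E * E)) : set E := snd @` G `|` (B `\` fst @` G).

Lemma lin_exchange_graph B S : lin_indep B -> B `<=` lin_span S ->
  exists G : set (E * E), [/\ G `<=` B `*` S, B `<=` fst @` G &
    forall p q, G p -> G q -> p.2 = q.2 -> p.1 = q.1].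
Proof.
move=> iB BS.
(* The third condition keeps the range of [G] disjoint from the part of [B] not yet exchanged, so an
   unexchanged [b] is nobody's partner. *)
pose Q (G : set (E * E)) := [/\ G `<=` B `*` S,
  forall p q, G p -> G q -> p.2 = q.2 -> p.1 = q.1,
  forall p, G p -> B p.2 -> (fst @` G) p.2 & lin_indep (exchange B G)].
have QU F : F `<=` Q -> total_on F subset -> Q (\bigcup_(X in F) X).
  move=> FQ Ft; split.
  - by move=> p [X FX Xp]; have [XBS _ _ _] := FQ _ FX; exact: XBS.
  - move=> p q [X FX Xp] [Y FY Yq].
    have [_ Xinj _ _] := FQ _ FX; have [_ Yinj _ _] := FQ _ FY.
    by have [/(_ _ Xp)|/(_ _ Yq)] := Ft _ _ FX FY; [move=> /Yinj|move=> /(Xinj _ _ Xp)]; exact.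
  - move=> p [X FX Xp] Bp; have [_ _ /(_ _ Xp Bp)[q Xq qp] _] := FQ _ FX.
    by exists q => //; exists X.
  move=> s c us sU s0.
  (* [s] is finite and [F] is a chain, so one member of [F] accounts for all exchanged vectors in
     [s]; [set0] serves when there are none. *)
  have [X XF sX] : exists2 X, F X \/ X = set0 & [set` s] `<=` exchange B X.
    have [X XF sX] : exists2 X, F X \/ X = set0 & [set` s] `<=`
        snd @` X `|` (B `\` fst @` (\bigcup_(X in F) X)).
      elim: s sU {us s0} => [_|a s IHs sU]; first by exists set0; [right|].
      have [|X XF sX] := IHs; first by move=> v vs; apply: sU; rewrite /= inE vs orbT.
      have [[p [Y FY Yp] pa]|aB] : exchange B (\bigcup_(X in F) X) a.
      - by apply: sU; rewrite /= inE eqxx.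
      - have aY : (snd @` Y) a by exists p.
        have [|XY|YX] : [\/ F X /\ Y `<=` X, X `<=` Y | Y `<=` X].
        + case: XF => [FX|->]; last by apply: Or32.
          by have [] := Ft _ _ FX FY; [apply: Or32|apply: Or33].
        + move=> [FX YX]; exists X; first by left.
          move=> v; rewrite /= inE => /orP[/eqP->|/sX//].
          by left; case: aY => q /YX Xq <-; exists q.
        + exists Y; first by left.
          move=> v; rewrite /= inE => /orP[/eqP->|/sX[[q /XY Yq <-]|]];
            by [left|left; exists q|right].
        exists X; first exact: XF.
        move=> v; rewrite /= inE => /orP[/eqP->|/sX//].
        by left; case: aY => q /YX Xq <-; exists q.
      exists X; first exact: XF.
      by move=> v; rewrite /= inE => /orP[/eqP->|/sX//]; right.
    exists X; first exact: XF.
    move=> v /sX[|[Bv nv]]; [by left|right; split=> // -[p Xp pv]].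
    case: XF Xp => [FX Xp|->//]; apply: nv; exists p => //; by exists X.
  case: XF sX => [/FQ[_ _ _ iX]|-> sX]; first by move=> sX; exact: (iX s c).
  apply: (iB s c) => // v /sX[[]//|[]//].
have [G [[GBS Ginj Gdis iG] Gmax]] := Zorn_bigcup QU.
exists G; split=> // b Bb; apply: contrapT => nGb.
set D := exchange B G `\ b.
have iD : lin_indep D by apply: lin_indep_sub iG => v [].
have GDb : exchange B G b by right.
(* If all of [S] lay in the span of [D], so would [b], against independence. An [x] outside that
   span can replace [b], and [(b, x)] then extends the maximal [G]. *)
have [x Sx Dx] : exists2 x, S x & ~ lin_span D x.
  apply: contrapT => nS; apply: (lin_indep_notin_span iG GDb).
  apply: (lin_span_trans _ (BS _ Bb)) => x Sx.
  by apply: contrapT => Dx; apply: nS; exists x.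
have nDx : ~ D x by move=> /sub_lin_span.
have bG p : G p -> p.2 <> b.
  by move=> Gp pb; apply: nGb; rewrite -pb; apply: Gdis => //; rewrite pb.
have xG p : G p -> p.2 <> x.
  by move=> Gp px; apply: nDx; split; [left; exists p|rewrite -px; exact: bG].
apply: (Gmax (G `|` [set (b, x)])).
  split; first by move=> v; left.
  by move=> /(_ (b, x) (or_intror erefl)) Gbx; apply: nGb; exists (b, x).
split.
- by move=> p [/GBS//|->].
- move=> p q [Gp|->] [Gq|->] //=; first exact: Ginj.
    by move=> /(xG _ Gp).
  by move=> /esym/(xG _ Gq).
- move=> p [Gp /(Gdis _ Gp)[q Gq <-]|-> /= Bx]; first by exists q => //; left.
  apply: contrapT => nx; apply: nDx; split.
    by right; split=> // -[q Gq qx]; apply: nx; exists q => //; left.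
  by move=> xb; apply: nx; exists (b, x) => //; right.
apply: lin_indep_sub (lin_indepU1 iD Dx) => v [[p [Gp|->] <-]|[Bv nv]].
- by left; split; [left; exists p|exact: bG].
- by right.
- left; split; last by move=> vb; apply: nv; exists (b, x) => //; right.
  by right; split=> // -[q Gq qv]; apply: nv; exists q => //; left.
Qed.

(** [G] need not be single-valued; since no two elements of [B] share a partner, any choice of
    partners is injective. *)
Lemma card_le_lin_indep B S : lin_indep B -> B `<=` lin_span S -> B #<= S.
Proof.
move=> iB BS; have [G [GBS BG Ginj]] := lin_exchange_graph iB BS.
have /choice[f fE] b : exists x, B b -> G (b, x).
  have [/BG[p Gp <-]|nBb] := EM (B b); last by exists 0.
  by exists p.2; rewrite -surjective_pairing.
have fI : {in B &, injective f}.
  move=> b b'; rewrite !inE => /fE Gb /fE Gb' ff.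
  by have := Ginj _ _ Gb Gb' ff.
apply: (@card_le_trans _ _ _ (f @` B)).
  by have := inj_card_eq fI; rewrite card_eq_le => /andP[].
by apply: subset_card_le => _ [b /fE/GBS[_ ?] <-].
Qed.

Lemma dimP P : is_basis P (Defs.dim P).
Proof. exact: svalP (cid (is_basis_exists P)). Qed.

End Span.

(** * Maps linear on a subset, and images of independent sets *)

Section LinearOn.
Variables (k : fieldType) (E E' : lmodType k).

(** A [{linear}] structure would ask too much: the maps in view are built from chosen
    representatives and are controlled only on multilinear elements. *)
Definition linear_on (P : set E) (h : E -> E') :=
  forall (s : seq E) (c : E -> k), [set` s] `<=` P ->
  h (\sum_(v <- s) c v *: v) = \sum_(v <- s) c v *: h v.

Lemma lin_span_linear_on P B (h : E -> E') x : linear_on P h -> B `<=` P ->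
  lin_span B x -> lin_span (h @` B) (h x).
Proof.
move=> hP BP [s [c [sB ->]]]; rewrite hP; last by move=> v /sB/BP.
by apply: lin_span_sum => v /sB Bv; apply: sub_lin_span; exists v.
Qed.

Lemma lin_indep_image P B (h : E -> E') : linear_on P h -> B `<=` P ->
  (forall x, lin_span B x -> h x = 0 -> x = 0) ->
  lin_indep B -> lin_indep (h @` B) /\ {in B &, injective h}.
Proof.
move=> hP BP h0 iB.
have hI : {in B &, injective h}.
  move=> x y /[!inE] Bx By hxy; apply: contrapT => /eqP xy.
  have /h0 : lin_span B (\sum_(v <- [:: x; y]) (if v == x then 1 else -1) *: v).
    by apply: lin_span_sum => v; rewrite !inE => /orP[] /eqP->; exact: sub_lin_span.
  rewrite hP; last by move=> v; rewrite /= !inE => /orP[] /eqP->; exact: BP.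
  rewrite !big_cons !big_nil eqxx eq_sym (negbTE xy) !addr0 !scaleN1r !scale1r.
  by rewrite hxy subrr => /(_ erefl)/eqP; rewrite subr_eq0 (negbTE xy).
split=> // s c us sB s0 v vs.
have /choice[r rE] w : exists x, (h @` B) w -> B x /\ h x = w.
  have [[x Bx <-]|nw] := EM ((h @` B) w); first by exists x.
  by exists 0 => /nw.
have rB w : w \in s -> B (r w) /\ h (r w) = w by move=> /sB/rE.
have rsB : [set` map r s] `<=` B by move=> _ /= /mapP[w /rB[Bw _] ->].
have := iB (map r s) (fun u => c (h u)); rewrite map_inj_in_uniq; last first.
  by move=> x y /rB[_ {2}<-] /rB[_ {2}<-] ->.
move=> /(_ us rsB) rs0; rewrite -(rB _ vs).2; apply: rs0; last exact: map_f.
apply: h0; first by apply: lin_span_sum => u /rsB; exact: sub_lin_span.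
rewrite hP; last by move=> u /rsB/BP.
rewrite big_map -[RHS]s0; apply: eq_big_seq => w /rB[_ hw].
by rewrite hw.
Qed.

End LinearOn.

(** * Elementary algebra of bilinear maps *)

Section Bilinear.
Variables (k : fieldType) (U U' W : lmodType k) (b : U -> U' -> W).
Hypothesis bb : bilinear_for *:%R *:%R b.

Lemma bil_suml (I : Type) (s : seq I) (F : I -> U) y :
  b (\sum_(i <- s) F i) y = \sum_(i <- s) b (F i) y.
Proof.
pose f := b^~ y.
pose fL := GRing.isLinear.Build _ _ _ _ f (bb.1 _).
pose f' : {linear U -> W} := HB.pack f fL.
exact: (linear_sum f').
Qed.

Lemma bil_sumr (I : Type) (s : seq I) (F : I -> U') x :
  b x (\sum_(i <- s) F i) = \sum_(i <- s) b x (F i).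
Proof.
pose fL := GRing.isLinear.Build _ _ _ _ (b x) (bb.2 _).
pose f' : {linear U' -> W} := HB.pack (b x) fL.
exact: (linear_sum f').
Qed.

Lemma bil_sum (I J : Type) (s : seq I) (t : seq J) (F : I -> U) (G : J -> U') :
  b (\sum_(i <- s) F i) (\sum_(j <- t) G j) =
  \sum_(i <- s) \sum_(j <- t) b (F i) (G j).
Proof. by rewrite bil_suml; apply: eq_bigr => i _; rewrite bil_sumr. Qed.

Lemma bilPl c x x' y : b (c *: x + x') y = c *: b x y + b x' y.
Proof. exact: bb.1. Qed.

Lemma bilPr c x y y' : b x (c *: y + y') = c *: b x y + b x y'.
Proof. exact: bb.2. Qed.

Lemma bilBl x x' y : b (x - x') y = b x y - b x' y.
Proof. by rewrite -[- x']scaleN1r [x + _]addrC bilPl scaleN1r addrC. Qed.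

Lemma bilBr x y y' : b x (y - y') = b x y - b x y'.
Proof. by rewrite -[- y']scaleN1r [y + _]addrC bilPr scaleN1r addrC. Qed.

Lemma bilZr c x y : b x (c *: y) = c *: b x y.
Proof.
have b0 : b x 0 = 0 by rewrite -[X in b x X](subrr 0) bilBr subrr.
by rewrite -[c *: y]addr0 bilPr b0 addr0.
Qed.

End Bilinear.

(** * Evaluation of monomials and linearity in one variable *)

Section Evaluation.
Variables (k : fieldType) (Om : Type) (B : algebra k Om).
Implicit Types (a b : nat -> B) (m : monomial Om).

Lemma eq_in_meval a b m : {in leaves m, a =1 b} -> meval a m = meval b m.
Proof.
elim: m => [i|w m1 IH1 m2 IH2] /= ab; first by apply: ab; rewrite inE.
by rewrite IH1 ?IH2 // => i im; apply: ab; rewrite mem_cat im ?orbT.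
Qed.

Definition update a (i : nat) (x : B) := fun j => if j == i then x else a j.

(** Exactly one factor of a product contains the variable [i]; the other one is constant in [x]. *)
Lemma meval_update_linear a i m : count_mem i (leaves m) = 1%N ->
  linear (fun x => meval (update a i x) m).
Proof.
have notin m' x y : count_mem i (leaves m') = 0%N ->
    meval (update a i x) m' = meval (update a i y) m'.
  move=> /count_memPn im'; apply: eq_in_meval => j jm'.
  by rewrite /update; case: eqP jm' im' => // -> ->.
elim: m => [j|w m1 IH1 m2 IH2] /=.
  by rewrite addn0 => /eqP; rewrite eqb1 => /eqP-> c x y; rewrite /update eqxx.
rewrite count_cat => cm c x y.
case c1: (count_mem i (leaves m1)) cm => [|[|//]] /= c2.
  by rewrite IH2 // (notin m1 _ x) // (notin m1 y x) // (bilPr (op_bilinear w)).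
case: c2 => c2.
by rewrite IH1 // (notin m2 _ x) // (notin m2 y x) // (bilPl (op_bilinear w)).
Qed.

Lemma feval_update_linear a i (f : nonassoc_poly k Om) :
  all (fun p => count_mem i (leaves p.2) == 1%N) f ->
  linear (fun x => feval (meval (update a i x)) f).
Proof.
elim: f => [|p f IHf] /= => [_ c x y|/andP[/eqP p1 /IHf fL] c x y].
  by rewrite /feval !big_nil scaler0 addr0.
move: (fL c x y); rewrite /feval !big_cons => ->.
rewrite meval_update_linear // !scalerDr !scalerA mulrC !addrA.
by congr (_ + _); rewrite addrAC.
Qed.

End Evaluation.

(** * Pure tensors suffice to test multilinear identities *)

Section TensorBox.
Variables (k : fieldType) (Omega : Type).
Variables (Z : algebra k unit) (A : dialgebra k Omega).

Lemma tensor_sum (t : tensor Z A) : exists s : fsum k (Z * A)%type,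
  t = \sum_(q <- s) q.1 *: tens q.2.1 q.2.2.
Proof.
exists (repr t); apply: qeval_inj => i.
pose fL := GRing.isLinear.Build _ _ _ _ _ (@qeval_linear _ _ _ _ (@bil_eval k Z A) i).
pose F : {linear tensor Z A -> bil_cod i} := HB.pack (@qeval _ _ _ _ (@bil_eval k Z A) i) fL.
rewrite -[RHS]/(F _) linear_sum; apply: eq_bigr => q _.
by rewrite linearZ /= qeval_pi /feval big_seq1 scale1r.
Qed.

Lemma identity_box n (f : nonassoc_poly k Omega) :
  all (fun p => is_multilinear n p.2) f ->
  (forall (z : nat -> Z) (a : nat -> A),
     feval (meval (fun i => tens (z i) (a i) : box Z A)) f = 0) ->
  identity (box Z A) f.
Proof.
move=> fn f0.
have fleaves p : p \in f -> perm_eq (leaves p.2) (iota 0 n).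
  by move=> pf; exact: (allP fn).
(* [j] counts the leading variables allowed arbitrary values. The induction step expands the value
   of variable [j] into pure tensors and uses that [f] is linear in it. *)
suff fj j : forall b : nat -> box Z A,
    (forall i, (j <= i < n)%N -> exists (z : Z) (a : A), b i = tens z a) ->
    feval (meval b) f = 0.
  move=> b; apply: (fj n) => i /andP[ni]; by rewrite ltnNge ni.
elim: j => [|j IHj] b bn.
  have /choice[za zaE] i : exists za : Z * A, (i < n)%N -> b i = tens za.1 za.2.
    case: (ltnP i n) => [lin|_]; last by exists (0, 0).
    by have [z [a ->]] := bn _ lin; exists (z, a).
  rewrite -[RHS](f0 (fst \o za) (snd \o za)); apply: eq_big_seq => p pf.
  congr (_ *: _); apply: eq_in_meval => i.
  by rewrite (perm_mem (fleaves _ pf)) mem_iota add0n => /zaE.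
have [nj|jn] := leqP n j.
  apply: IHj => i /andP[ji lin]; have := leq_ltn_trans (leq_trans nj ji) lin.
  by rewrite ltnn.
have [s sE] := tensor_sum (b j).
have fL0 : linear (fun x => feval (meval (update b j x)) f).
  apply: feval_update_linear; apply/allP => p /fleaves/permP ->.
  by rewrite count_uniq_mem ?iota_uniq // mem_iota jn.
pose fL := GRing.isLinear.Build _ _ _ _ _ fL0.
pose F : {linear box Z A -> box Z A} :=
  HB.pack (fun x => feval (meval (update b j x)) f) fL.
transitivity (F (b j)).
  apply: eq_big_seq => p pf; congr (_ *: _); apply: eq_in_meval => i _.
  by rewrite /update; case: eqP => // ->.
rewrite sE linear_sum big1 // => q _; rewrite linearZ /= IHj ?scaler0 //.
move=> i /andP[ji lin]; rewrite /update; case: eqP => [_|/eqP ij].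
  by exists q.2.1, q.2.2.
by apply: bn; rewrite lin andbT ltn_neqAle eq_sym ij.
Qed.

End TensorBox.

(** * Dialgebra monomials and their centers *)

Section Center.
Variable Omega : Type.
Implicit Types (m : monomial Omega) (q : monomial (Omega + Omega)).

(** For a leaf [j] of [m] this is m^(j). At nodes with no leaf [j] below them the test yields [inr]
    by default; such nodes lie on a bar side, where in di-Alg_0 either operation has the same
    effect. *)
Fixpoint center_lift (j : nat) m : monomial (Omega + Omega) :=
  match m with
  | Var i => Var i
  | Mul w m1 m2 => Mul (if j \in leaves m2 then inl w else inr w)
                       (center_lift j m1) (center_lift j m2)
  end.

Definition forget_op (s : Omega + Omega) : Omega :=
  match s with inl w => w | inr w => w end.

Fixpoint forget q : monomial Omega :=
  match q with
  | Var i => Var i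
  | Mul s q1 q2 => Mul (forget_op s) (forget q1) (forget q2)
  end.

Fixpoint center q : nat :=
  match q with
  | Var i => i
  | Mul (inl _) _ q2 => center q2
  | Mul (inr _) q1 _ => center q1
  end.

Lemma leaves_center_lift j m : leaves (center_lift j m) = leaves m.
Proof. by elim: m => //= w m1 -> m2 ->. Qed.

Lemma leaves_forget q : leaves (forget q) = leaves q.
Proof. by elim: q => //= s q1 -> q2 ->. Qed.

Lemma forget_center_lift j m : forget (center_lift j m) = m.
Proof. by elim: m => //= w m1 -> m2 ->; case: ifP. Qed.

Lemma center_leaves q : center q \in leaves q.
Proof.
elim: q => [i|[] w q1 IH1 q2 IH2] /=; first by rewrite inE.
  by rewrite mem_cat IH2 orbT.
by rewrite mem_cat IH1.
Qed.

Section DiAlgebra.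
Variables (k : fieldType) (A : dialgebra k Omega).
Hypothesis diA : di_alg0 A.

(* Equality of the images in the quotient on which |-_w and -|_w coincide, as
   far as it is seen from the bar side of an operation. *)
Definition bar_eq (x y : A) := forall u z,
  opl u x z = opl u y z /\ opr u z x = opr u z y.

(** The di-Alg_0 identities say that [|-_w] and [-|_w] of the same arguments are [bar_eq]. *)
Lemma bar_eq_op w (x x' y y' : A) s t : forget_op s = w -> forget_op t = w ->
  bar_eq x x' -> bar_eq y y' -> bar_eq (op s x y) (op t x' y').
Proof.
have lr v (p q : A) : bar_eq (opl v p q) (opr v p q).
  move=> u z; have [] := diA v u p q z; rewrite /opl bilBl; last exact: op_bilinear.
  move=> /eqP; rewrite subr_eq0 => /eqP -> _; split=> //.
  have [_ /eqP] := diA v u z p q; rewrite /opr bilBr; last exact: op_bilinear.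
  by rewrite subr_eq0 => /eqP.
move=> sw tw xx yy.
(* [|-_w] does not see the difference between [x] and [x'] on its left, nor [-|_w] that between [y]
   and [y'] on its right; switching the operation in between replaces both arguments. *)
have E : bar_eq (opl w x y) (opr w x' y').
  move=> u z; rewrite (xx w y).1 -(yy w x').2; exact: lr.
have bar_sym (p q : A) : bar_eq p q -> bar_eq q p.
  by move=> pq u z; rewrite (pq u z).1 (pq u z).2.
have bar_tr (p q r : A) : bar_eq p q -> bar_eq q r -> bar_eq p r.
  by move=> pq qr u z; rewrite (pq u z).1 (pq u z).2.
have l' : bar_eq (op s x y) (opl w x y).
  by case: s sw => v /= <- //; exact/bar_sym/lr.
apply: (bar_tr _ _ _ l'); apply: (bar_tr _ _ _ E).
by case: t tw => v /= <- //; exact/bar_sym/lr.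
Qed.

Lemma bar_eq_meval (a : nat -> A) p q :
  forget p = forget q -> bar_eq (meval a p) (meval a q).
Proof.
elim: p q => [i|s p1 IH1 p2 IH2] [j|t q1 q2] //=; first by case=> ->.
by case=> st /IH1 e1 /IH2 e2; apply: (bar_eq_op (erefl _)).
Qed.

(** Induction along the path from the root to the center: the other factor stands on a bar side,
    where only its image under [forget] counts. Distinctness of the leaves makes the membership test
    in [center_lift] choose the operation found in [q]. *)
Lemma meval_center (a : nat -> A) q : uniq (leaves q) ->
  meval a q = meval a (center_lift (center q) (forget q)).
Proof.
elim: q => [//|s q1 IH1 q2 IH2] /=.
rewrite cat_uniq => /and3P[/IH1 e1 /hasPn q12 /IH2 e2].
rewrite leaves_forget; case: s => w.
  rewrite center_leaves e2 /=.
  by apply: (bar_eq_meval _ _ _ _).1; rewrite forget_center_lift.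
rewrite ifN; last by apply: contraTN (center_leaves q1); exact: q12.
by rewrite e1; apply: (bar_eq_meval _ _ _ _).2; rewrite forget_center_lift.
Qed.

End DiAlgebra.
End Center.

(** * Expanding a monomial in the box product *)

Section BoxEvaluation.
Variables (k : fieldType) (Omega : Type).
Variables (Z : algebra k unit) (A : dialgebra k Omega).
Hypotheses (ZC : pre_com Z) (diA : di_alg0 A).
Variables (z : nat -> Z) (a : nat -> A).
Implicit Types (s t : seq nat) (m : monomial Omega).

Definition zprod s (y : Z) : Z := foldr (fun i => op tt (z i)) y s.

(* The sum of all words ending with j in the free Zinbiel algebra. *)
Definition zterm s j := zprod (rem j s) (z j).

(** The Zinbiel identity makes left multiplications commute: x(yz) = (xy + yx)z is symmetric in x
    and y. *)
Lemma zprod_perm s t y : perm_eq s t -> zprod s y = zprod t y.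
Proof.
have swap i s' x : zprod s' (op tt (z i) x) = op tt (z i) (zprod s' x).
  elim: s' => //= j s' ->.
  by rewrite -[LHS]ZC addrC ZC.
elim: s t => [|i s IHs] t st.
  by move: st; rewrite perm_sym => /perm_nilP->.
have it : i \in t by rewrite -(perm_mem st) inE eqxx.
case/splitPr: it st => t1 t2; rewrite perm_sym perm_catC cat_cons perm_cons.
rewrite perm_catC perm_sym => /IHs /= ->.
by rewrite /zprod !foldr_cat /= -!/(zprod _ _) swap.
Qed.

(** The sum of all [zterm s j] is the product of the [z i] under the commutative operation xy + yx.
    With t the sum for [s], the sum for [i :: s] is z_i t + t z_i, and left multiplication by it is
    that by t followed by that by z_i. *)
Lemma op_zterm_sum s y : s != [::] -> uniq s ->
  op tt (\sum_(j <- s) zterm s j) y = zprod s y.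
Proof.
elim: s y => // i s IHs y _ /= /andP[iNs us].
have [->|s0] := eqVneq s [::]; first by rewrite big_seq1 /zterm /= eqxx.
rewrite -(IHs y) // big_cons -ZC [in RHS](_ : op tt (z i) _ = 
  \sum_(j <- s) op tt (z i) (zterm s j)); last first.
  by rewrite bil_sumr //; exact: op_bilinear.
congr (op tt _ y); rewrite addrC; congr (_ + _).
  apply: eq_big_seq => j js; rewrite /zterm /= ifN //.
  by apply: contraNneq iNs => ->.
by rewrite IHs // /zterm /= eqxx.
Qed.

Lemma rem_cat (j : nat) s t :
  rem j (s ++ t) = if j \in s then rem j s ++ t else s ++ rem j t.
Proof.
elim: s => //= i s ->; rewrite inE eq_sym; case: eqP => //= _.
by case: ifP.
Qed.

Lemma zterm_catr s t j : j \notin s -> zterm (s ++ t) j = zprod s (zterm t j).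
Proof. by move=> /negbTE js; rewrite /zterm rem_cat js /zprod foldr_cat. Qed.

Lemma zterm_catl s t j : j \in s -> zterm (s ++ t) j = zprod t (zterm s j).
Proof.
move=> js; rewrite /zterm rem_cat js (zprod_perm _ (_ : perm_eq _ (t ++ rem j s))).
  by rewrite /zprod foldr_cat.
by rewrite perm_catC.
Qed.

Lemma zterm_perm s t j : perm_eq s t -> zterm s j = zterm t j.
Proof.
move=> st; apply: zprod_perm; have [js|js] := boolP (j \in s); last first.
  by rewrite !rem_id // -(perm_mem st).
rewrite -(perm_cons j) -(permPl (perm_to_rem js)) (permPl st).
by rewrite perm_to_rem // -(perm_mem st).
Qed.

(** In the product of two expansions, the factor on the bar side has the same effect for every
    choice of its center; summing over that center and applying [op_zterm_sum] produces the words
    for the whole leaf list. *)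
Lemma meval_box m : uniq (leaves m) ->
  meval (fun i => tens (z i) (a i) : box Z A) m =
  \sum_(j <- leaves m) tens (zterm (leaves m) j) (meval a (center_lift j m)).
Proof.
have leaves0 m' : leaves m' != [::].
  elim: m' => //= w p IHp q _.
  by rewrite -size_eq0 size_cat addn_eq0 size_eq0 (negbTE IHp).
elim: m => [i _|w m1 IH1 m2 IH2] /=.
  by rewrite big_seq1 /zterm /= eqxx.
rewrite cat_uniq => /and3P[u1 /hasPn m12 u2]; rewrite IH1 // IH2 //.
have m21 j : j \in leaves m1 -> j \notin leaves m2.
  by move=> j1; apply/negP => /m12; rewrite j1.
have bar m' i j : bar_eq (meval a (center_lift i m')) (meval a (center_lift j m')).
  by apply: bar_eq_meval => //; rewrite !forget_center_lift.
have tB := @tens_bilinear k Z A.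
rewrite [LHS](bil_sum (op_bilinear (a := box Z A) w)).
pose l i j := tens (op tt (zterm (leaves m1) i) (zterm (leaves m2) j))
  (opl w (meval a (center_lift i m1)) (meval a (center_lift j m2))).
pose r i j := tens (op tt (zterm (leaves m2) j) (zterm (leaves m1) i))
  (opr w (meval a (center_lift i m1)) (meval a (center_lift j m2))).
transitivity (\sum_(i <- leaves m1)
  (\sum_(j <- leaves m2) l i j + \sum_(j <- leaves m2) r i j)).
  apply: eq_bigr => i _; rewrite -big_split; apply: eq_bigr => j _.
  exact: box_opE.
(* The [-|_w] terms give the centers in [m1], the [|-_w] terms those in [m2]. *)
rewrite big_split /= big_cat /= addrC; congr (_ + _).
  apply: eq_big_seq => i im1; rewrite zterm_catl //.
  rewrite -(op_zterm_sum _ (leaves0 m2)) // bil_suml; last exact: op_bilinear.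
  rewrite bil_suml // (negbTE (m21 _ im1)); apply: eq_bigr => j _.
  by congr tens; exact: (bar _ _ _ _ _).2.
rewrite exchange_big /=; apply: eq_big_seq => j jm2; rewrite zterm_catr ?m12 //.
rewrite -(op_zterm_sum _ (leaves0 m1)) // bil_suml; last exact: op_bilinear.
rewrite bil_suml // jm2; apply: eq_bigr => i _.
by congr tens; exact: (bar _ _ _ _ _).1.
Qed.

Definition lift_poly j (f : nonassoc_poly k Omega) : nonassoc_poly k (Omega + Omega) :=
  [seq (p.1, center_lift j p.2) | p <- f].

Lemma feval_box n (f : nonassoc_poly k Omega) :
  all (fun p => is_multilinear n p.2) f ->
  feval (meval (fun i => tens (z i) (a i) : box Z A)) f =
  \sum_(j <- iota 0 n) tens (zterm (iota 0 n) j) (feval (meval a) (lift_poly j f)).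
Proof.
move=> fn; have tB := @tens_bilinear k Z A.
rewrite /feval; under [RHS]eq_bigr do rewrite big_map bil_sumr //.
rewrite exchange_big; apply: eq_big_seq => p /(allP fn) pn.
rewrite meval_box; last by rewrite (perm_uniq pn) iota_uniq.
rewrite scaler_sumr (perm_big _ pn) /=; apply: eq_bigr => j _.
by rewrite bilZr //= (zterm_perm _ pn).
Qed.

End BoxEvaluation.

(** * A Zinbiel algebra of polynomials *)

Section PolyZinbiel.
Variable k : fieldType.
Implicit Types p q : {poly k}.

Definition pint p : {poly k} := \poly_(i < (size p).+1) (p`_i.-1 / i%:R).

(* At i = 0 the right-hand side is 0, since 0^-1 = 0. *)
Lemma coef_pint p i : (pint p)`_i = p`_i.-1 / i%:R.
Proof.
rewrite coef_poly; case: ltnP => // pi; rewrite nth_default ?mul0r //.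
by rewrite -ltnS (leq_trans pi) // leqSpred.
Qed.

(** Removing the constant term of [p] kills the boundary term in integration by parts, so that the
    Zinbiel identity holds on all of k[t]. *)
Definition zpoly_op (_ : unit) p q := pint ((p - (p`_0)%:P) * q^`()).

Lemma zpoly_bilinear w : bilinear_for *:%R *:%R (zpoly_op w).
Proof.
have pintL : linear pint.
  move=> c p q; apply/polyP => i.
  by rewrite coefD coefZ !coef_pint coefD coefZ mulrDl mulrA.
split=> r c p q; rewrite -pintL /zpoly_op; congr pint.
  rewrite coefD coefZ polyCD polyCM -!mul_polyC opprD addrACA -mulrBr.
  by rewrite mulrDl mulrA.
by rewrite derivD derivZ mulrDr scalerAr.
Qed.

Definition zpoly : algebra k unit := Algebra zpoly_bilinear.

Hypothesis char0 : [pchar k] =i pred0.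

Lemma natr_neq0 n : (n.+1%:R : k) != 0.
Proof. by rewrite ((pcharf0P k).1 char0). Qed.

Lemma pintK p : (pint p)^`() = p.
Proof.
apply/polyP => i; rewrite coef_deriv coef_pint /= -[LHS]mulr_natr mulfVK //.
exact: natr_neq0.
Qed.

Lemma derivK p : pint p^`() = p - (p`_0)%:P.
Proof.
apply/polyP => -[|i]; rewrite coef_pint coefB coefC /=.
  by rewrite invr0 mulr0 subrr.
by rewrite coef_deriv -[X in X / _]mulr_natr mulfK ?subr0 ?natr_neq0.
Qed.

(** Integration by parts: xy + yx is the ordinary product of [x] and [y] stripped of their constant
    terms, while differentiation undoes the inner integral in x(yz). *)
Lemma pre_com_zpoly : pre_com zpoly.
Proof.
move=> x y z; rewrite /= /zpoly_op.
set x0 := x - _; set y0 := y - _.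
have xE : x^`() = x0^`() by rewrite derivB derivC subr0.
have yE : y^`() = y0^`() by rewrite derivB derivC subr0.
have pint0 p : (pint p)`_0 = 0 by rewrite coef_pint invr0 mulr0.
rewrite coefD !pint0 addr0 subr0 pintK mulrA; congr (pint (_ * _)).
have x00 : x0`_0 = 0 by rewrite coefB coefC subrr.
have -> : x0 * y0 = x0 * y0 - ((x0 * y0)`_0)%:P.
  by rewrite coef0M x00 mul0r subr0.
rewrite -derivK derivM xE yE; apply/polyP => i.
by rewrite coefD !coef_pint coefD -mulrDl addrC [y0 * _]mulrC.
Qed.

Lemma zpoly_opXn c a b : (0 < a)%N -> (0 < b)%N ->
  zpoly_op tt 'X^a (c *: 'X^b) = (c * b%:R / (a + b)%:R) *: 'X^(a + b).
Proof.
case: a b => // a [//|b] _ _; rewrite /zpoly_op coefXn subr0.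
rewrite derivZ derivXn /= -scalerAr ['X^_ * _]mulrnAr -exprD; apply/polyP => i.
rewrite coef_pint !coefZ coefMn !coefXn addSn addnS.
case: i => [|i] /=; first by rewrite invr0 !mulr0.
rewrite eqSS; case: eqP => [->|_]; last by rewrite mul0rn mulr0 mul0r mulr0.
by rewrite mulr1 addSn.
Qed.

(** The coefficients telescope: each new factor contributes the old total exponent over the new one,
    starting from e_j over e_j. *)
Lemma zterm_zpoly (e : nat -> nat) (s : seq nat) j :
  (forall i, 0 < e i)%N -> j \in s ->
  zterm (fun i => 'X^(e i) : zpoly) s j =
  ((e j)%:R / (\sum_(i <- s) e i)%:R) *: 'X^(\sum_(i <- s) e i).
Proof.
move=> e0 js; rewrite (perm_big _ (perm_to_rem js)) big_cons /= /zterm.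
elim: (rem j s) => [|i t IHt].
  rewrite /= big_nil addn0 divff ?scale1r //.
  by case: (e j) (e0 j) => // d _; exact: natr_neq0.
rewrite big_cons addnCA [LHS](_ : _ = zpoly_op tt 'X^(e i)
   (zprod (fun i => 'X^(e i) : zpoly) t 'X^(e j))) // IHt zpoly_opXn //.
  by rewrite mulfVK //; case: (e j) (e0 j) => // d _; exact: natr_neq0.
by rewrite addn_gt0 e0.
Qed.

End PolyZinbiel.

(** * Linear combinations in the free algebra of a class *)

Section FreeAlgebra.
Variables (k : fieldType) (Om : Type) (M : algebra_class k Om).

Lemma free_class0P f :
  free_class M f = 0 <-> (forall A, M A -> identity A f).
Proof.
split=> [f0 A MA a|f0].
  have := congr1 (@qeval _ _ _ _ (@int_eval k Om M) (Interpretation MA a)) f0.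
  by rewrite qeval_pi => ->; rewrite qeval_pi /feval big_nil.
by apply: fpi_eq => -[A MA a]; rewrite [RHS]big_nil; exact: f0.
Qed.

Definition lin_comb (I : Type) (s : seq I) (c : I -> k)
  (F : I -> nonassoc_poly k Om) : nonassoc_poly k Om :=
  flatten [seq fscale (c i) (F i) | i <- s].

Lemma feval_lin_comb (W : lmodType k) (phi : monomial Om -> W) (I : Type)
    (s : seq I) c F :
  feval phi (lin_comb s c F) = \sum_(i <- s) c i *: feval phi (F i).
Proof.
elim: s => [|i s IHs]; first by rewrite big_nil /feval big_nil.
by rewrite big_cons /lin_comb /= feval_cat feval_scale IHs.
Qed.

Lemma free_class_lin_comb (I : Type) (s : seq I) c F :
  free_class M (lin_comb s c F) =
  \sum_(i <- s) c i *: free_class M (F i) :> free_algebra M.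
Proof.
apply: qeval_inj => i; rewrite qeval_pi feval_lin_comb.
pose L := GRing.isLinear.Build _ _ _ _ _
  (@qeval_linear _ _ _ _ (@int_eval k Om M) i).
pose G : {linear free_car M -> int_alg i} :=
  HB.pack (@qeval _ _ _ _ (@int_eval k Om M) i) L.
rewrite -[RHS]/(G _) linear_sum; apply: eq_bigr => j _.
by rewrite linearZ /= qeval_pi.
Qed.

Lemma free_class_sum (f : nonassoc_poly k Om) :
  free_class M f = \sum_(p <- f) p.1 *: free_class M [:: (1, p.2)] :> free_algebra M.
Proof.
rewrite -free_class_lin_comb; apply: fpi_eq => i.
rewrite feval_lin_comb; apply: eq_bigr => p _.
by rewrite /feval big_seq1 scale1r.
Qed.

Lemma all_lin_comb (P : pred (monomial Om)) (I : eqType) (s : seq I) c F :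
  (forall i, i \in s -> all (fun p => P p.2) (F i)) ->
  all (fun p => P p.2) (lin_comb s c F).
Proof.
move=> FP; apply/allP => _ /flattenP[_ /mapP[i /FP/allP iP ->] /mapP[p pF ->]].
exact: iP _ pF.
Qed.

Lemma multilinear_part_sum n (I : eqType) (s : seq I) (c : I -> k) G :
  (forall i, i \in s -> multilinear_part M n (G i)) ->
  multilinear_part M n (\sum_(i <- s) c i *: G i).
Proof.
move=> Gn; have /choice[F FE] i : exists f : nonassoc_poly k Om, i \in s ->
    all (fun p => is_multilinear n p.2) f /\ G i = free_class M f.
  have [/Gn[f fn ->]|nis] := EM (i \in s); first by exists f.
  by exists [::] => /nis.
exists (lin_comb s c F); first by apply: all_lin_comb => i /FE[].
by rewrite free_class_lin_comb; apply: eq_big_seq => i /FE[_ ->].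
Qed.

End FreeAlgebra.

(** * Identities and multilinear parts of V against those of its hat *)

Section Hat.
Variables (k : fieldType) (Omega : Type) (V : algebra_class k (Omega + Omega)).
Hypotheses (char0 : [pchar k] =i pred0) (V_di : subclass V (@di_alg0 k Omega)).
Implicit Types f : nonassoc_poly k Omega.

Lemma hat_identityP n f : all (fun p => is_multilinear n p.2) f ->
  (forall A, hat V A -> identity A f) <->
  (forall A, V A -> forall j, (j < n)%N -> identity A (lift_poly j f)).
Proof.
move=> fn; split=> [hf A VA j jn a|Vf A].
  have hatA : hat V (box (zpoly k) A).
    move=> M _ KM; apply: KM; exists (zpoly k), A; split=> //.
    exact: pre_com_zpoly.
  pose F i := feval (meval a) (lift_poly i f).
  (* Substitute the pure tensors of t^(e_i) and a_i and take the coefficient of t^N, with N the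
     total exponent: this is the relation up to the factor 1/N. *)
  have key (e : nat -> nat) : (forall i, 0 < e i)%N ->
      \sum_(i <- iota 0 n) (e i)%:R *: F i = 0.
    move=> e0; pose N := (\sum_(i <- iota 0 n) e i)%N.
    have /= := hf _ hatA (fun i => tens ('X^(e i) : zpoly k) (a i)).
    rewrite (feval_box (pre_com_zpoly char0) (V_di VA) _ _ fn).
    pose b (p : zpoly k) (v : A) : A := (p : {poly k})`_N *: v.
    have bb : bilinear_for *:%R *:%R b.
      split=> [v c p q|p c v w]; rewrite /b /=.
        by rewrite coefD coefZ scalerDl scalerA.
      by rewrite scalerDr !scalerA mulrC.
    have [g gL gE] := tens_universal bb.
    pose gL' := GRing.isLinear.Build _ _ _ _ g gL.
    pose g' : {linear tensor (zpoly k) A -> A} := HB.pack g gL'.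
    move=> /(congr1 g'); rewrite linear_sum linear0 /= => sum0.
    (* [j] is an index below [n], so [N] is positive, hence invertible in characteristic 0. *)
    have N0 : (N%:R : k) != 0.
      rewrite ((pcharf0P k).1 char0) /N (perm_big _ (@perm_to_rem _ j _ _)).
        by rewrite big_cons addn_eq0 negb_and -lt0n e0.
      by rewrite mem_iota.
    transitivity (N%:R *: (0 : A)); last exact: scaler0.
    rewrite -[in RHS]sum0 scaler_sumr.
    apply: eq_big_seq => i iin; rewrite gE /b zterm_zpoly // -/N coefZ coefXn eqxx.
    by rewrite mulr1 scalerA mulrC mulfVK.
  (* Comparing all exponents 1 with exponent 2 at [j] and 1 elsewhere isolates [F j]. *)
  have e1 := key (fun=> 1%N) (fun=> isT).
  have := key (fun i => (i == j).+1) (fun=> isT).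
  under eq_bigr => i _ do rewrite -add1n natrD scalerDl.
  rewrite big_split /= e1 add0r (perm_big _ (@perm_to_rem _ j _ _)); last first.
    by rewrite mem_iota.
  rewrite big_cons /= eqxx scale1r big_seq big1 ?addr0 // => i.
  by rewrite mem_rem_uniq ?iota_uniq // inE => /andP[/negbTE-> _]; rewrite scale0r.
(* The algebras satisfying [f] form a variety, so only the generators of [hat V] need checking. *)
move=> hA; apply: (hA (fun B => identity B f)).
  by exists [set f] => B; split=> [fB _ ->//|fB]; exact: fB.
move=> _ [Z [B [ZC VB ->]]]; apply: (identity_box fn) => z a.
rewrite (feval_box ZC (V_di VB) _ _ fn) big_seq big1 // => j.
rewrite mem_iota add0n /= => jn; rewrite (Vf _ VB) //.
have tB := @tens_bilinear k Z B.
by rewrite -(scale0r (0 : B)) bilZr // scale0r.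
Qed.

Lemma lift_poly_lin_comb j (I : Type) (s : seq I) (c : I -> k)
    (F : I -> nonassoc_poly k Omega) :
  lift_poly j (lin_comb s c F) = lin_comb s c (fun i => lift_poly j (F i)).
Proof.
rewrite /lift_poly /lin_comb map_flatten -map_comp; congr flatten.
by apply: eq_map => i /=; rewrite /fscale -!map_comp.
Qed.

Lemma lift_poly_multilinear n j f : all (fun p => is_multilinear n p.2) f ->
  all (fun p => is_multilinear n p.2) (lift_poly j f).
Proof.
rewrite /lift_poly all_map => fn; apply: sub_all fn => p /=.
by rewrite /is_multilinear leaves_center_lift.
Qed.

(** By [hat_identityP], a multilinear f vanishes in the free algebra of [hat V] exactly when all
    f^(j) vanish in that of [V]. Hence [G j], defined through chosen representatives, does not
    depend on them, and the [G j] have trivial common kernel. *)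
Lemma hat_component n : exists G : nat -> free_algebra (hat V) -> free_algebra V,
  [/\ forall j f, (j < n)%N -> all (fun p => is_multilinear n p.2) f ->
        G j (free_class (hat V) f) = free_class V (lift_poly j f),
      forall j, (j < n)%N -> linear_on (multilinear_part (hat V) n) (G j)
    & forall x, multilinear_part (hat V) n x ->
        (forall j, (j < n)%N -> G j x = 0) -> x = 0].
Proof.
have /choice[r rE] (x : free_algebra (hat V)) : exists f, multilinear_part (hat V) n x ->
    all (fun p => is_multilinear n p.2) f /\ x = free_class (hat V) f.
  have [[f fn ->]|nx] := EM (multilinear_part (hat V) n x); first by exists f.
  by exists [::] => /nx.
pose G j x := free_class V (lift_poly j (r x)).
have lift0 f : all (fun p => is_multilinear n p.2) f ->
    free_class (hat V) f = 0 <->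
    (forall j, (j < n)%N -> free_class V (lift_poly j f) = 0).
  move=> fn; split=> [/free_class0P/(hat_identityP fn) f0 j jn|f0].
    by apply/free_class0P => A VA; exact: f0.
  apply/free_class0P/(hat_identityP fn) => A VA j jn.
  by apply: (free_class0P _ _).1 VA; exact: f0.
have GE j f : (j < n)%N -> all (fun p => is_multilinear n p.2) f ->
    G j (free_class (hat V) f) = free_class V (lift_poly j f).
  move=> jn fn; set x := free_class _ f.
  have [rn rx] : all (fun p => is_multilinear n p.2) (r x) /\ x = free_class (hat V) (r x).
    by apply: rE; exists f.
  pose d := lin_comb [:: (1 : k, r x); (-1, f)] fst snd.
  have dn : all (fun p => is_multilinear n p.2) d.
    by apply: (all_lin_comb (P := is_multilinear n)) => i; rewrite !inE => /orP[] /eqP->.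
  have dE : free_class (hat V) d = 0.
    by rewrite free_class_lin_comb !big_cons big_nil addr0 /= -rx scale1r scaleN1r subrr.
  have := (lift0 _ dn).1 dE j jn; rewrite lift_poly_lin_comb free_class_lin_comb.
  rewrite !big_cons big_nil addr0 /= scale1r scaleN1r => /eqP.
  by rewrite subr_eq0 => /eqP.
exists G; split=> //.
  move=> j jn s c sP; have sr v : v \in s -> _ := fun vs => rE v (sP v vs).
  have -> : \sum_(v <- s) c v *: v = free_class (hat V) (lin_comb s c r).
    by rewrite free_class_lin_comb; apply: eq_big_seq => v /sr[_ <-].
  rewrite GE // ?lift_poly_lin_comb ?free_class_lin_comb //.
  by apply: (all_lin_comb (P := is_multilinear n)) => v /sr[].
move=> _ [f fn ->] Gf; apply/(lift0 _ fn) => j jn; rewrite -GE //; exact: Gf.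
Qed.

(** A dialgebra monomial [q] is the component at [center q] of its underlying monomial, so the [n]
    images of a basis for [hat V] together span. *)
Lemma codim_le_hat n : codim V n #<= `I_n `*` codim (hat V) n.
Proof.
have [BV iB _] := dimP (multilinear_part V n).
have [BH _ sH] := dimP (multilinear_part (hat V) n).
have [G [GE GL _]] := hat_component n.
apply: card_le_trans (card_image_le (fun p => G p.1 p.2) _).
apply: card_le_lin_indep iB _ => x /BV[f fn ->]; rewrite free_class_sum.
apply: lin_span_sum => -[c q] /(allP fn) /= qn.
have uq : uniq (leaves q) by rewrite (perm_uniq qn) iota_uniq.
have cn : (center q < n)%N.
  by have := center_leaves q; rewrite (perm_mem qn) mem_iota.
have fq : all (fun p => is_multilinear n p.2) [:: (1 : k, forget q)].
  by rewrite /= andbT /is_multilinear leaves_forget.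
have -> : free_class V [:: (1, q)] = G (center q) (free_class (hat V) [:: (1, forget q)]).
  rewrite GE //; apply: fpi_eq => -[A VA a]; rewrite /feval !big_seq1 /=.
  by congr (_ *: _); apply: meval_center uq; exact: V_di.
apply: (@lin_span_trans _ _ (G (center q) @` codim (hat V) n)).
  by move=> _ [y Hy <-]; apply: sub_lin_span; exists (center q, y).
apply: lin_span_linear_on (GL _ cn) BH _; apply: sH.
by exists [:: (1, forget q)].
Qed.

(** The [n] components together embed the multilinear part for [hat V] into n-tuples; the tuples
    [d (j, v)], with a basis vector [v] for [V] in place [j], span a space containing the image. *)
Lemma codim_hat_le n : codim (hat V) n #<= `I_n `*` codim V n.
Proof.
have [_ _ sV] := dimP (multilinear_part V n).
have [BH iH _] := dimP (multilinear_part (hat V) n).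
have [G [GE GL G0]] := hat_component n.
pose h (x : free_algebra (hat V)) : {ffun 'I_n -> free_algebra V} :=
  [ffun j : 'I_n => G j x].
have hL : linear_on (multilinear_part (hat V) n) h.
  move=> s c sP; apply/ffunP => j; rewrite ffunE GL // sum_ffunE.
  by apply: eq_bigr => v _; rewrite !ffunE.
have [|ihB hI] := lin_indep_image hL BH _ iH.
  move=> x [s [c [sB ->]]] hx; apply: G0.
    by apply: multilinear_part_sum => v /sB/BH.
  by move=> j jn; move/ffunP: hx => /(_ (Ordinal jn)); rewrite !ffunE.
have := inj_card_eq hI; rewrite card_eq_le => /andP[_ hB].
apply: (card_le_trans hB).
pose d (p : nat * free_algebra V) : {ffun 'I_n -> free_algebra V} :=
  [ffun j : 'I_n => if j == p.1 :> nat then p.2 else 0].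
apply: card_le_trans (card_image_le d _).
apply: card_le_lin_indep ihB _ => _ [x /BH[f fn ->] <-].
have -> : h (free_class (hat V) f) =
    \sum_(j < n) 1 *: d (nat_of_ord j, free_class V (lift_poly j f)).
  apply/ffunP => i; rewrite ffunE GE // sum_ffunE (bigD1 i) //= big1.
    by rewrite !ffunE eqxx scale1r addr0.
  by move=> j ji; rewrite !ffunE /= eq_sym val_eqE (negbTE ji) scaler0.
apply: lin_span_sum => j _.
have [s [c [sB ->]]] : lin_span (codim V n) (free_class V (lift_poly j f)).
  by apply: sV; exists (lift_poly j f) => //; exact: lift_poly_multilinear.
have -> : d (nat_of_ord j, \sum_(v <- s) c v *: v) =
    \sum_(v <- s) c v *: d (nat_of_ord j, v).
  apply/ffunP => i; rewrite ffunE sum_ffunE /=; case: eqP => ij.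
    by apply: eq_bigr => v _; rewrite !ffunE /= ij eqxx.
  by rewrite big1 // => v _; rewrite !ffunE /= ifN ?scaler0 //; apply/eqP.
apply: lin_span_sum => v /sB Bv; apply: sub_lin_span.
by exists (nat_of_ord j, v) => //; split=> //=.
Qed.

End Hat.

(** * Cardinal bounds and growth rates *)

Section Growth.

Lemma card_le_mulII (T U : Type) (A : set T) (B : set U) n c :
  A #<= `I_n `*` B -> B #= `I_c -> exists2 d, A #= `I_d & (d <= n * c)%N.
Proof.
move=> AB /card_set_bijP[f [fB fI _]].
(* As [f] takes values below [c] on [B], division by [c] recovers [p.1] and [f p.2]. *)
pose g (p : nat * U) := (p.1 * c + f p.2)%N.
have gI : {in `I_n `*` B &, injective g}.
  move=> [i x] [j y]; rewrite !inE => -[/= _ Bx] [/= _ By] gg.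
  have fx : (f x < c)%N := fB _ Bx.
  have fy : (f y < c)%N := fB _ By.
  have c0 : (0 < c)%N := leq_ltn_trans (leq0n _) fx.
  have ij : i = j.
    by have := congr1 (divn^~ c) gg; rewrite /g /= !divnMDl // !divn_small // !addn0.
  by move: gg; rewrite /g /= ij => /addnI /fI ->; rewrite ?inE.
have Anc : A #<= `I_(n * c).
  apply: (card_le_trans AB).
  have := inj_card_eq gI; rewrite card_eq_le => /andP[_ /card_le_trans]; apply.
  apply: subset_card_le => _ [[i x] [/= lin Bx] <-].
  have fx : (f x < c)%N := fB _ Bx.
  by rewrite /g /= (@leq_trans (i.+1 * c)) // ?leq_mul // mulSn addnC ltn_add2r.
have /finite_setP[d Ad] : finite_set A by apply/finite_set_leP; exists (n * c)%N.
by exists d; rewrite // -card_le_II -(card_le_eql Ad).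
Qed.

Variables (R : realType) (k : fieldType) (Om Om' : Type).
Variables (M : algebra_class k Om) (M' : algebra_class k Om').
Hypothesis MM' : forall n, (0 < n)%N -> codim M n #<= `I_n `*` codim M' n.

Lemma codim_le_muln n (x : R) : (0 < n)%N ->
  codim_le M' n x -> codim_le M n (n%:R * x).
Proof.
move=> n0 [c cE cx]; have [d dE dc] := card_le_mulII (MM' n0) cE.
exists d => //; apply: (@le_trans _ _ (n * c)%:R); first by rewrite ler_nat.
by rewrite natrM ler_wpM2l.
Qed.

Lemma polynomial_growth_muln : polynomial_growth R M' -> polynomial_growth R M.
Proof.
move=> [p pM]; exists ('X * p) => n n0; rewrite hornerM hornerX.
exact: codim_le_muln (pM n n0).
Qed.

(** With b = sqrt a, the Bernoulli-type bound n(b - 1) <= b^n absorbs the factor n: n C b^n <= C/(b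
    - 1) a^n. *)
Lemma subexponential_muln : subexponential R M' -> subexponential R M.
Proof.
move=> sM a a1; pose b := Num.sqrt a.
have b1 : 1 < b by rewrite -sqrtr1 ltr_sqrt // (lt_trans ltr01).
have bb : b * b = a by rewrite -expr2 sqr_sqrtr // (le_trans ler01) // ltW.
have [C C0 CM] := sM b b1.
have bern n : n%:R * (b - 1) <= b ^+ n.
  elim: n => [|n IHn]; first by rewrite mul0r expr0 ler01.
  have bn1 : 1 <= b ^+ n by rewrite exprn_ege1 // ltW.
  have -> : b ^+ n.+1 = b ^+ n + (b - 1) * b ^+ n.
    by rewrite exprS mulrBl mul1r addrC subrK.
  rewrite -addn1 natrD mulrDl mul1r lerD // -[leLHS]mulr1.
  by rewrite ler_wpM2l // subr_ge0 ltW.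
have b10 : 0 < b - 1 by rewrite subr_gt0.
exists ((b - 1)^-1 * C); first by rewrite mulr_gt0 ?invr_gt0.
move=> n n0; have [c cE cC] := codim_le_muln n0 (CM n n0).
exists c => //; apply: (le_trans cC); rewrite -bb exprMn mulrC.
have -> : (b - 1)^-1 * C * (b ^+ n * b ^+ n) = C * b ^+ n * ((b - 1)^-1 * b ^+ n).
  by rewrite [_^-1 * C]mulrC -!mulrA; congr (C * _); exact: mulrCA.
have bn0 : 0 <= b ^+ n by rewrite exprn_ge0 // ltW // (lt_trans ltr01).
by rewrite ler_wpM2l ?mulr_ge0 ?(ltW C0) // [leRHS]mulrC ler_pdivlMr.
Qed.

End Growth.

Theorem theorem4 (R : realType) (k : fieldType) (Omega : Type)
    (V : algebra_class k (Omega + Omega))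
    (char0 : [pchar k] =i pred0)
    (V_variety : is_variety V) (V_di : subclass V (@di_alg0 k Omega)) :
  (forall n : nat, (1 <= n)%N ->
     codim V n #<= `I_n `*` codim (hat V) n /\
     codim (hat V) n #<= `I_n `*` codim V n) /\
  (polynomial_growth R V <-> polynomial_growth R (hat V)) /\
  (intermediate_growth R V <-> intermediate_growth R (hat V)).
Proof.
have C1 n : (0 < n)%N -> codim V n #<= `I_n `*` codim (hat V) n.
  by move=> _; exact: codim_le_hat.
have C2 n : (0 < n)%N -> codim (hat V) n #<= `I_n `*` codim V n.
  by move=> _; exact: codim_hat_le.
have P : polynomial_growth R V <-> polynomial_growth R (hat V).
  by split; exact: polynomial_growth_muln.
split; first by move=> n n0; split; [exact: C1|exact: C2].
(* Failure of polynomial growth transfers by [P], subexponentiality by [C1] or [C2]. *)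
split=> //; split=> -[nP sub]; split;
  by [rewrite -P | rewrite P | exact: subexponential_muln sub].
Qed.
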